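(* Let $R^*$ be an integer-valued query on datasets, let $\mathcal{D}$ be the symmetric relation consisting of the pairs of admissible datasets that differ in exactly one value, and let $\Delta = \max_{(D,D')\in\mathcal{D}} |R^*(D)-R^*(D')|$ be the (finite) sensitivity of the query. Let $b$ be a non-negative integer with $b \geq \Delta$. Let $g:[0,b]\to[0,\infty)$, put $G(z)=\sum_{x=0}^{z} g(x)$ for $z\in\{0,\ldots,b\}$ and $G(-1)=0$, and suppose that $g(b)+2G(b-1)=1$. Let $Z$ be a random variable on $\{-b,-b+1,\ldots,b\}$ with cumulative distribution function $$\mathbb{P}(Z\le z)=\begin{cases} G(z+b) & \text{if } z\in\{-b,\ldots,0\},\\ 1-G(b-z-1) & \text{if } z\in\{0,\ldots,b\}.\end{cases}$$ Then the mechanism that on dataset $D$ returns $R(D)=R^*(D)+Z$ satisfies $(\epsilon,\delta)$-differential privacy with $\delta = G(\Delta-1)$ and $$\epsilon=\log\left(\max_{(D,D')}\ \max_{a\in A'(D,D')}\frac{\mathbb{P}(R(D)=a)}{\mathbb{P}(R(D')=a)}\right),$$ where the outer maximum is over all $(D,D')\in\mathcal{D}$ with $R^*(D)\ge R^*(D')$, and $$A'(D,D')=\{a\in\mathbb{Z} : R^*(D)-b\le a\le R^*(D')+b\}.$$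
   Context: A dataset is a finite collection (multiset) of user values; a non-empty family of admissible datasets is fixed. The relation $\mathcal{D}$ is the set of ordered pairs $(D,D')$ of admissible datasets such that one of $D,D'$ is obtained from the other by removing exactly one value; in particular $(D,D')\in\mathcal{D}$ if and only if $(D',D)\in\mathcal{D}$, and $\mathcal{D}$ is assumed non-empty. For a dataset $D$, $R^*(D)\in\mathbb{Z}$ denotes the true result of the query and $R(D)$ the (random) result returned by the server. A mechanism $R$ satisfies $(\epsilon,\delta)$-differential privacy if for all $(D,D')\in\mathcal{D}$ and all subsets $S$ of the result space $\mathbb{Z}$, $$\mathbb{P}(R(D)\in S)\le e^{\epsilon}\,\mathbb{P}(R(D')\in S)+\delta .$$ The noise added for each dataset has the same distribution, namely that of $Z$. The logarithm is the natural logarithm. The function $g$ may take the value $0$; in the definition of $\epsilon$, points $a$ at which numerator and denominator are both $0$ are disregarded, a positive number divided by $0$ is read as $+\infty$, and if $\epsilon=+\infty$ the assertion is vacuous. *)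

(* Defs.v *)
From HB Require Import structures.
From mathcomp Require Import all_boot all_order all_algebra finmap multiset.
From mathcomp Require Import all_classical all_reals all_analysis.

Set Implicit Arguments.
Unset Strict Implicit.
Unset Printing Implicit Defensive.

Import Order.TTheory GRing.Theory Num.Theory.
Local Open Scope classical_set_scope.
Local Open Scope ring_scope.

HB.instance Definition _ := isPointed.Build int (Posz 0).

(* Every set of integers is an event. *)
HB.instance Definition _ := @isMeasurable.Build default_measure_display
  int (@discrete_measurable int) (@discrete_measurable0 int)
  (@discrete_measurableC int) (@discrete_measurableU int).

Definition is_maximum (d : Order.disp_t) (T : porderType d)
    (A : set T) (m : T) : Prop :=
  A m /\ ubound A m.

(* [D `\ v] lowers the multiplicity of [v] in [D] by one. *)
Definition removes_one (V : choiceType) (D D' : multiset V) : Prop :=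
  exists2 v, v \in D & D' = (D `\ v)%mset.

Definition neighbours (V : choiceType) (adm : set (multiset V)) :
    set (multiset V * multiset V) :=
  [set p | [/\ adm p.1, adm p.2 & removes_one p.1 p.2 \/ removes_one p.2 p.1]].

Definition is_sensitivity (V : choiceType) (adm : set (multiset V))
    (query : multiset V -> int) (Delta : nat) : Prop :=
  is_maximum [set `|query p.1 - query p.2|%N | p in neighbours adm] Delta.

(* [partial_sum g z] is [g 0 + ... + g z]; it is the empty sum at [z = -1]. *)
Definition partial_sum (R : realType) (b : nat) (g : 'I_b.+1 -> R) (z : int) : R :=
  \sum_(x < b.+1 | x%:Z <= z) g x.

Section Mechanisms.
Context (d : measure_display) (Omega : measurableType d) (R : realType).
Variable P : probability Omega R.

Section Shift.
Variables (c : int) (X : {RV P >-> int}).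

Definition shift_RV (w : Omega) : int := c + X w.

Let shift_RV_measurable : measurable_fun setT shift_RV.
Proof.
move=> _ S _; rewrite setTI.
have -> : shift_RV @^-1` S = X @^-1` [set k | S (c + k)] by [].
by rewrite -[X in measurable X]setTI; exact: (measurable_funPT X).
Qed.

HB.instance Definition _ :=
  isMeasurableFun.Build _ _ Omega int shift_RV shift_RV_measurable.
End Shift.

Variables (V : choiceType) (adm : set (multiset V)).

Definition additive_mechanism (query : multiset V -> int)
    (noise : multiset V -> {RV P >-> int}) : multiset V -> {RV P >-> int} :=
  fun D => shift_RV (query D) (noise D).

Definition differentially_private (M : multiset V -> {RV P >-> int})
    (eps delta : R) : Prop :=
  forall D D', neighbours adm (D, D') -> forall S : set int,
    (distribution P (M D) S
       <= (expR eps)%:E * distribution P (M D') S + delta%:E)%E.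

(* In [\bar R], [p / 0] is [+oo] for [p > 0]. The points where numerator and
   denominator both vanish are excluded explicitly, since there [0 / 0 = 0]. *)
Definition probability_ratios (M : multiset V -> {RV P >-> int})
    (A : set int) (D D' : multiset V) : set (\bar R) :=
  [set (distribution P (M D) [set a] / distribution P (M D') [set a])%E
     | a in [set a | A a /\ ~ (distribution P (M D) [set a] = 0%E /\
                               distribution P (M D') [set a] = 0%E)]].

End Mechanisms.

Definition common_window (V : choiceType) (query : multiset V -> int) (b : nat)
    (D D' : multiset V) : set int :=
  [set a | query D - b%:Z <= a <= query D' + b%:Z].

(* Main.v *)
Require Import Defs.
From HB Require Import structures.
From mathcomp Require Import all_boot all_order all_algebra finmap multiset.
From mathcomp Require Import all_classical all_reals all_analysis.
From mathcomp Require Import zify ring.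

Set Implicit Arguments.
Unset Strict Implicit.
Unset Printing Implicit Defensive.

Import Order.TTheory GRing.Theory Num.Theory.
Local Open Scope classical_set_scope.
Local Open Scope ring_scope.

(* The noise is symmetric, and its mass beyond b - k, for 1 <= k <= b, is
   G(k - 1), as is its mass below k - b. On the window of a pair (D, D') with
   R*(D) - R*(D') = k >= 0 the mass of R(D) at a point is at most rho_max times
   that of R(D'); the mass of R(D) off the window is G(k - 1) <= G(Delta - 1).
   The reflection of the window about its centre exchanges the two
   distributions, hence gives the same bound with D and D' swapped. Only
   finitely many ratios occur, so the maxima exist; one ratio is positive
   because some z in [-b, 0] carries mass, hence exp (ln rho_max) = rho_max. *)

(** * Finite maxima and extended-real quotients *)

Lemma finite_set_maximum (d : Order.disp_t) (T : orderType d) (A : set T) :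
  finite_set A -> A !=set0 -> exists m, is_maximum A m.
Proof.
move=> /finite_seqP[s ->] {A}.
elim: s => [[x]|x s IH _]; first by rewrite /= in_nil.
case: s IH => [_|y s /(_ _)[|m [/= ms mub]]].
- by exists x; split=> [|y] /=; rewrite mem_seq1// => /eqP ->.
- by exists y => /=; exact: mem_head.
exists (Order.max x m); split => [/=|z /=].
  by rewrite /Order.max; case: ifP => _; rewrite in_cons ?ms ?eqxx ?orbT.
rewrite in_cons le_max => /orP[/eqP ->|zs]; first by rewrite lexx.
by rewrite (mub z zs) orbT.
Qed.

Lemma finite_int_interval (x y : int) : finite_set [set k : int | x <= k <= y].
Proof.
apply: sub_finite_set (finite_image (fun n : nat => x + n%:Z)
  (finite_II (`|y - x|%N).+1)) => k /= xky.
by exists `|k - x|%N => /=; lia.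
Qed.

Lemma le_mul_of_ratio_le (R : realType) (x y : \bar R) (r : R) :
  (0 <= x -> x \is a fin_num -> 0 <= y -> y \is a fin_num ->
   ~ (x = 0 /\ y = 0) -> x / y <= r%:E -> x <= r%:E * y)%E.
Proof.
case: x => [x| |]// x0 _; case: y => [y| |]// y0 _ nxy.
rewrite inver; case: ifPn => [/eqP y_eq0|y_neq0].
  (* For [y = 0] the excluded case [0 / 0] leaves [x > 0], and then [x / y = +oo] cannot be below
     the real [r]. *)
  rewrite gt0_muley// lt_neqAle x0 andbT.
  by apply/eqP => x_eq0; apply: nxy; rewrite y_eq0 -x_eq0.
by rewrite lee_pdivrMr// lt_neqAle eq_sym y_neq0 -lee_fin.
Qed.

(** * Comparison of measures through point masses *)

Lemma measure_finite_set_le (d : measure_display) (T : measurableType d)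
    (R : realType) (mu nu : {measure set T -> \bar R}) (c : \bar R) (A : set T) :
  (forall a : T, measurable [set a]) -> finite_set A ->
  (forall a, A a -> mu [set a] <= c * nu [set a])%E ->
  (mu A <= c * nu A)%E.
Proof.
move=> mset1 finA le_mu_nu.
have trivA : trivIset A (fun a : T => [set a]).
  by move=> i j _ _ [k [/= -> ->]].
rewrite -(fsbig_setU_set1 finA) !measure_fsbig//.
by rewrite ge0_mule_fsumr//; exact: lee_fsum.
Qed.

(** Splitting [S] along [W], the factor [c] pays for the part inside, point by point, and [delta]
    absorbs the part outside. *)
Lemma measure_le_off_window (d : measure_display) (T : measurableType d)
    (R : realType) (mu nu : {measure set T -> \bar R}) (c delta : R)
    (W S : set T) :
  (forall A : set T, measurable A) -> finite_set W -> 0 <= c ->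
  (forall a, W a -> mu [set a] <= c%:E * nu [set a])%E ->
  (mu (~` W) <= delta%:E)%E ->
  (mu S <= c%:E * nu S + delta%:E)%E.
Proof.
move=> mT finW c0 leW leC.
rewrite -(setIT S) -(setUv W) setIUr measureU//; last first.
  by rewrite setIACA setICr setI0.
apply: leeD; last first.
  by apply: le_trans leC; apply: le_measure; rewrite ?inE//; exact: subIsetr.
apply: (@le_trans _ _ (c%:E * nu (S `&` W))%E).
  apply: measure_finite_set_le => //; first exact: finite_setIr.
  by move=> a [_ /leW].
apply: lee_wpmul2l; first by rewrite lee_fin.
by apply: le_measure; rewrite ?inE// -setIUr setUv setIT; exact: subIsetl.
Qed.

(** * Symmetry and atoms of the noise *)

Lemma measure_int1 (R : realType) (mu : probability int R) (z : int) :
  mu [set z]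
    = (mu [set k : int | (k <= z)%R] - mu [set k : int | (k <= z - 1)%R])%E.
Proof.
have -> : [set k : int | k <= z] = [set k : int | k <= z - 1] `|` [set z].
  by apply/seteqP; split => k /=; [|case]; lia.
rewrite measureU//; first by rewrite addeAC subee ?add0e// fin_num_measure.
by apply/seteqP; split => k //=; lia.
Qed.

(** For [0 < z <= b], differencing either branch of the distribution function gives the same mass
    [G (b - z) - G (b - z - 1)]. *)
Lemma measure_int1_opp (R : realType) (mu : probability int R) (b : nat)
    (G : int -> R) :
  (forall z, z < 0 -> G z = 0) ->
  (mu [set k : int | ~~ (- b%:Z <= k <= b%:Z)%R] = 0)%E ->
  (forall z : int, - b%:Z <= z <= 0 ->
     mu [set k | k <= z] = (G (z + b%:Z))%:E) ->
  (forall z : int, 0 <= z <= b%:Z ->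
     mu [set k | k <= z] = (1 - G (b%:Z - z - 1))%:E) ->
  forall z : int, mu [set - z] = mu [set z].
Proof.
move=> G0 supp cdf_neg cdf_pos z.
have null (A : set int) :
    A `<=` [set k : int | ~~ (- b%:Z <= k <= b%:Z)] -> mu A = 0%E.
  by move=> sA; apply: (subset_measure0 _ _ sA supp).
wlog z_gt0 : z / 0 < z.
  move=> sym; have [z0|z0|->] := ltrgt0P z; last by rewrite oppr0.
  - exact: sym.
  - by rewrite -[in RHS](opprK z) [RHS]sym// oppr_gt0.
have [b_lt_z|z_le_b] := ltP b%:Z z.
  by rewrite !null// => k /= ->; lia.
rewrite !measure_int1 (cdf_pos z) ?(cdf_pos (z - 1)) ?(cdf_neg (- z)); try lia.
have -> : mu [set k | k <= - z - 1] = (G (b%:Z - z - 1))%:E.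
  (* At [z = b] the point [- z - 1] lies below the range of the formula; both sides are then [0],
     since [G (-1) = 0]. *)
  have [z_lt_b|b_le_z] := ltP z b%:Z.
    by rewrite cdf_neg; [congr (G _)%:E|]; lia.
  by rewrite null ?G0//; [lia|move=> k /=; lia].
have -> : b%:Z - (z - 1) - 1 = - z + b%:Z by lia.
by rewrite -!EFinB; congr EFin; ring.
Qed.

Lemma partial_sum_homo (R : realType) (b : nat) (g : 'I_b.+1 -> R) :
  (forall x, 0 <= g x) -> {homo partial_sum g : x y / x <= y}.
Proof.
move=> g0 x y xy; rewrite /partial_sum.
rewrite [leLHS]big_mkcond [leRHS]big_mkcond; apply: ler_sum => i _ /=.
case: ifPn => [ix|_]; first by rewrite (le_trans ix xy).
by case: ifP.
Qed.

Lemma partial_sum_lt0 (R : realType) (b : nat) (g : 'I_b.+1 -> R) (z : int) :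
  z < 0 -> partial_sum g z = 0.
Proof.
by move=> z0; rewrite /partial_sum big1// => i iz; lia.
Qed.

Lemma neighbours_sym (V : choiceType) (adm : set (multiset V)) D D' :
  neighbours adm (D, D') -> neighbours adm (D', D).
Proof. by move=> [? ? DD']; split=> //=; apply/or_comm. Qed.

(** Otherwise symmetry would make every point of [[-b, b]] null, and the total mass would be [0]. *)
Lemma probability_exists_atom (R : realType) (mu : probability int R) (b : nat) :
  (forall z : int, mu [set - z] = mu [set z]) ->
  (mu [set k : int | ~~ (- b%:Z <= k <= b%:Z)%R] = 0)%E ->
  exists2 z : int, - b%:Z <= z <= 0 & (0 < mu [set z])%E.
Proof.
move=> sym supp; apply: contrapT => noatom.
have mu0 z : - b%:Z <= z <= b%:Z -> mu [set z] = 0%E.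
  wlog z_le0 : z / z <= 0.
    move=> sym_le0; have [/sym_le0//|z_gt0 zb] := leP z 0.
    by rewrite -sym; apply: sym_le0; lia.
  move=> zb; apply/eqP; rewrite eq_le measure_ge0 andbT leNgt.
  by apply/negP => mu_gt0; apply: noatom; exists z => //; lia.
(* Comparing [mu] with itself at factor [0] turns null points into a null interval. *)
have := @measure_finite_set_le _ _ _ mu mu 0%E [set k : int | - b%:Z <= k <= b%:Z].
rewrite mul0e => /(_ (fun=> I) (finite_int_interval _ _)) le0.
have : (mu setT <= 0)%E.
  rewrite -(setUv [set k : int | - b%:Z <= k <= b%:Z]).
  rewrite measureU//; last by rewrite setICr.
  rewrite [X in (_ + X)%E](_ : _ = 0%E); last first.
    by rewrite -[RHS]supp; congr (mu _); apply/seteqP; split => k /= /negP.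
  by rewrite adde0; apply: le0 => a /mu0 mua; rewrite mul0e -[leRHS]mua.
by rewrite probability_setT lee_fin ler10.
Qed.

Theorem theoremC1 (R : realType) (V : choiceType)
    (adm : set (multiset V)) (adm_neq0 : adm !=set0)
    (nbr_neq0 : neighbours adm !=set0)
    (query : multiset V -> int) (Delta : nat)
    (Delta_sens : is_sensitivity adm query Delta)
    (b : nat) (Delta_le_b : (Delta <= b)%N)
    (g : 'I_b.+1 -> R) (g_ge0 : forall x, 0 <= g x)
    (g_sum : g ord_max + 2 * partial_sum g (b%:Z - 1) = 1)
    (d : measure_display) (Omega : measurableType d) (P : probability Omega R)
    (Z : {RV P >-> int})
    (Z_range : forall w, - b%:Z <= Z w <= b%:Z)
    (Z_cdf_neg : forall z : int, - b%:Z <= z <= 0 ->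
       distribution P Z [set k | k <= z] = (partial_sum g (z + b%:Z))%:E)
    (Z_cdf_pos : forall z : int, 0 <= z <= b%:Z ->
       distribution P Z [set k | k <= z]
         = (1 - partial_sum g (b%:Z - z - 1))%:E)
    (noise : multiset V -> {RV P >-> int})
    (noise_Z : forall D, adm D -> forall S : set int,
       distribution P (noise D) S = distribution P Z S) :
  let M := additive_mechanism query noise in
  let ordered_nbr :=
    [set p | neighbours adm p /\ query p.2 <= query p.1] in
  exists (rho : multiset V * multiset V -> \bar R) (rho_max : \bar R),
    [/\ forall p, ordered_nbr p ->
          is_maximum
            (probability_ratios M (common_window query b p.1 p.2) p.1 p.2)
            (rho p),
        is_maximum [set rho p | p in ordered_nbr] rho_max
      & rho_max != +oo%E ->
          differentially_private adm M (ln (fine rho_max))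
            (partial_sum g (Delta%:Z - 1))].
Proof.
move=> M ordered_nbr.
pose mu : probability int R := distribution P Z.
have G0 := @partial_sum_lt0 R b g.
have supp : mu [set k : int | ~~ (- b%:Z <= k <= b%:Z)] = 0%E.
  rewrite -(measure0 P) /mu /distribution /pushforward; congr (P _).
  by apply/seteqP; split => // w /=; rewrite Z_range.
have sym : forall z : int, mu [set - z] = mu [set z].
  exact: measure_int1_opp G0 supp Z_cdf_neg Z_cdf_pos.
have sens D D' : neighbours adm (D, D') -> (`|query D - query D'| <= Delta)%N.
  by move=> DD'; case: Delta_sens => _; apply; exists (D, D').
have distM D S : adm D -> distribution P (M D) S = mu [set k | S (query D + k)].
  by move=> admD; exact: (noise_Z D admD).
have distM1 D a : adm D -> distribution P (M D) [set a] = mu [set a - query D].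
  by move=> /distM ->; congr (mu _); apply/seteqP; split => k /=; lia.

(* Existence and positivity of the maxima *)
pose ratios p :=
  probability_ratios M (common_window query b p.1 p.2) p.1 p.2.
(* [quotients] is a finite set independent of the pair, so it bounds the outer maximum too, even
   over infinitely many pairs. *)
pose atoms : set (\bar R) :=
  [set mu [set z] | z in [set z : int | - b%:Z <= z <= b%:Z]].
pose quotients : set (\bar R) := [set (x / y)%E | x in atoms & y in atoms].
have fin_quotients : finite_set quotients.
  by apply: finite_image2; apply: finite_image; exact: finite_int_interval.
have ratios_sub p : ordered_nbr p -> ratios p `<=` quotients.
  case: p => D D' [/[dup] /sens + [/= admD admD' _]] /= le_q.
  move=> le_Delta r [a [/= a_win _] <-].
  move: a_win; rewrite /common_window /= => a_win.
  exists (mu [set a - query D]); first by exists (a - query D) => //=; lia.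
  exists (mu [set a - query D']); first by exists (a - query D') => //=; lia.
  by rewrite !distM1.
have [z0 z0b z0_gt0] := probability_exists_atom sym supp.
have ratios_pos p : ordered_nbr p -> exists2 r, ratios p r & (0 < r)%E.
  case: p => D D' [/[dup] /sens + [/= admD admD' _]] /= le_q => le_Delta.
  (* The point [query D + z0] lies in the window because [z0 <= 0] and
     [query D - query D' <= Delta <= b]. *)
  have num : distribution P (M D) [set query D + z0] = mu [set z0].
    by rewrite distM1//; congr (mu [set _]); lia.
  exists (distribution P (M D) [set (query D + z0)%R]
          / distribution P (M D') [set (query D + z0)%R])%E.
    exists (query D + z0) => //; split.
      by rewrite /common_window /=; lia.
    by rewrite num => -[mu0 _]; move: z0_gt0; rewrite mu0 ltxx.
  rewrite num mule_gt0// lt_neqAle inve_ge0 measure_ge0 andbT eq_sym inve_eq0.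
  by rewrite -ltey ltey_eq fin_num_measure.
have /choice[rho rho_max_of] : forall p, exists m,
    ordered_nbr p -> is_maximum (ratios p) m.
  (* The value [0] is a mere default off [ordered_nbr]. *)
  move=> p; have [op|nop] := pselect (ordered_nbr p); last by exists 0%E.
  have [r rp _] := ratios_pos p op.
  have [|m mmax] := @finite_set_maximum _ _ (ratios p) _ (ex_intro _ r rp).
    exact: sub_finite_set (ratios_sub p op) fin_quotients.
  by exists m.
have [p0 op0] : ordered_nbr !=set0.
  case: nbr_neq0 => -[D D'] DD'; have [le|lt] := leP (query D') (query D).
    by exists (D, D').
  by exists (D', D); split; [exact: neighbours_sym|exact: ltW].
have [|rho_max [rho_max_in rho_max_ub]] :=
    @finite_set_maximum _ _ [set rho p | p in ordered_nbr] _
      (ex_intro _ (rho p0) (ex_intro2 _ _ p0 op0 erefl)).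
  apply: sub_finite_set fin_quotients => _ [p op <-].
  by apply: (ratios_sub p op); have [] := rho_max_of p op.
exists rho, rho_max; split => // rho_max_fin.
have ratio_le p r : ordered_nbr p -> ratios p r -> (r <= rho_max)%E.
  move=> op rp; apply: (@le_trans _ _ (rho p)).
    by have [_] := rho_max_of p op; exact.
  by apply: rho_max_ub; exists p.
have rho_max_gt0 : (0 < rho_max)%E.
  have [r rp r_gt0] := ratios_pos p0 op0.
  exact: lt_le_trans r_gt0 (ratio_le _ _ op0 rp).
have rho_maxE : (fine rho_max)%:E = rho_max.
  by rewrite fineK// gt0_fin_numE// ltey.
have fine_gt0 : 0 < fine rho_max by rewrite -lte_fin rho_maxE.

(* Bounds on the window and on the tails *)
have window_le D D' a : neighbours adm (D, D') -> query D' <= query D ->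
    common_window query b D D' a ->
    (mu [set (a - query D)%R]
       <= (fine rho_max)%:E * mu [set (a - query D')%R])%E.
  move=> DD' le_q a_win; have [admD admD' _] := DD'.
  have [[-> ->]|nz] := pselect (mu [set a - query D] = 0%E /\
                                 mu [set a - query D'] = 0%E).
    by rewrite mule0.
  apply: le_mul_of_ratio_le => //; rewrite ?fin_num_measure//.
  rewrite rho_maxE; apply: (ratio_le (D, D')) => //.
  by exists a; rewrite /= !distM1.
have tail_le (A B : set int) (k : nat) : (k <= Delta)%N ->
    mu B = (partial_sum g (k%:Z - 1))%:E ->
    A `<=` B `|` [set j : int | ~~ (- b%:Z <= j <= b%:Z)] ->
    (mu A <= (partial_sum g (Delta%:Z - 1))%:E)%E.
  move=> le_k muB sAB; apply: le_trans (_ : mu B <= _)%E; last first.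
    by rewrite muB lee_fin; apply: partial_sum_homo => //; lia.
  rewrite -[leRHS](measureU0 _ _ supp)//.
  by apply: le_measure; rewrite ?inE.

(* The privacy inequality, by the order of the two query values *)
move=> D D' DD' S; have [admD admD' _] := DD'; have le_Delta := sens _ _ DD'.
rewrite lnK ?posrE//.
have [le_q|lt_q] := leP (query D') (query D).
  apply: (@measure_le_off_window _ _ _ (distribution P (M D))
    (distribution P (M D')) _ _ (common_window query b D D')) => //.
  - exact: finite_int_interval.
  - exact: ltW.
  - move=> a a_win; have := window_le _ _ _ DD' le_q a_win.
    by rewrite -(distM1 D)// -(distM1 D').
  rewrite [leLHS]distM//.
  (* Up to a null set, leaving the window means noise above [b - k] with [k = query D - query D'],
     of mass [1 - (1 - G(k - 1))]. *)
  apply: (tail_le _ (~` [set k : int | k <= b%:Z - (query D - query D')])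
            `|query D - query D'|%N) => //.
    rewrite probability_setC// [mu _]Z_cdf_pos; last by lia.
    by rewrite -EFinB subKr; congr (partial_sum g _)%:E; lia.
  by move=> k; rewrite /common_window /= /setU /setC /=; lia.
apply: (@measure_le_off_window _ _ _ (distribution P (M D))
  (distribution P (M D')) _ _ (common_window query b D' D)) => //.
- exact: finite_int_interval.
- exact: ltW.
- move=> a a_win; rewrite [leLHS]distM1// [X in (_ * X)%E]distM1//.
  rewrite -(sym (a - query D)) -(sym (a - query D')).
  (* The reflection [a |-> query D + query D' - a] preserves the window and,
     the noise being symmetric, exchanges the roles of [D] and [D']. *)
  have := @window_le D' D (query D + query D' - a).
  have -> : query D + query D' - a - query D' = - (a - query D) by lia.
  have -> : query D + query D' - a - query D = - (a - query D') by lia.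
  apply; [exact: neighbours_sym|exact: ltW|].
  by move: a_win; rewrite /common_window /=; lia.
rewrite [leLHS]distM//.
(* Now the lower tail escapes: noise at most [k - b - 1] with [k = query D' - query D]. As
   [1 <= k <= b], this point lies in [[-b, 0]], and the mass is [G(k - 1)]. *)
apply: (tail_le _ [set k : int | k <= query D' - query D - b%:Z - 1]
          `|query D - query D'|%N) => //.
  by rewrite [mu _]Z_cdf_neg; [congr (partial_sum g _)%:E|]; lia.
by move=> k; rewrite /common_window /= /setU /setC /=; lia.
Qed.
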